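(* Let $H$ be a countably infinite index set, $w=(w_i)_{i\in H}$, and let $D=(D_{ij})_{i,j\in H}$, $G=(G_{ij})_{i,j\in H}$ be complex matrices such that $D$ has an inverse $D^{-1}$ and $GD^{-1}$ is well-defined. Let $(Q_i(w))_{i\in H}$ be the canonical solution of the $Q$-system $$\prod_{j\in H}(Q_j(w))^{D_{ij}}+w_i\prod_{j\in H}(Q_j(w))^{G_{ij}}=1\qquad(i\in H).$$ For $\nu\in\boldsymbol{\nu}(D)$ let $Q^\nu_{D,G}(w):=\prod_{i\in H}(Q_i(w))^{\nu_i}$. Then $$Q^\nu_{D,G}(w)=K^\nu_{D,G}(w)/K^0_{D,G}(w)=R^\nu_{D,G}(w),$$ where $\boldsymbol\nu(D)$, $K^\nu_{D,G}$, $R^\nu_{D,G}$ are defined in the context.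
   Context: Fix finite subsets $H_1\subset H_2\subset\cdots\subset H$ with union $H$ (nothing depends on this choice). Put $w_L=(w_i)_{i\in H_L}$; $\mathbb{C}[[w]]$ is the projective limit of the rings $\mathbb{C}[[w_L]]$ (with the adic topologies for the ideals generated by the variables) along the projections killing $w_i$, $i\in H_{L'}\setminus H_L$. Its elements are formal sums $\sum_{N\in\mathcal N}a_Nw^N$, where $\mathcal N=\{N=(N_i)_{i\in H}\mid N_i\in\mathbb{Z}_{\ge0},\text{ all but finitely many }N_i=0\}$ and $w^N=\prod_i w_i^{N_i}$. For $f\in\mathbb{C}[[w]]$ with constant term $1$ and $\alpha\in\mathbb{C}$, $f^\alpha$ is the $\alpha$-th power with constant term $1$. Infinite products are required to converge irrespective of the order of factors. Products of infinite matrices are well-defined when each entry is a sum with all but finitely many terms zero; this is required of $DD^{-1}=D^{-1}D=I$ and $GD^{-1}$. The inverse $D^{-1}$ is fixed. Solutions of the $Q$-system are families of power series with constant terms $1$; a solution is canonical if $\prod_{j\in H}\{\prod_{k\in H}(Q_k(w))^{(D^{-1})_{ij}D_{jk}}\}=Q_i(w)$ for every $i\in H$. There is a unique canonical solution. $\boldsymbol\nu(D)$ is the set of all $\nu=(\nu_i)_{i\in H}$, $\nu_i\in\mathbb{C}$, such that for each $i$ all but finitely many $\nu_j(D^{-1})_{ji}$ ($j\in H$) are zero. For such $\nu$ the product $\prod_i (Q_i(w))^{\nu_i}$ exists. $\binom{a}{b}=\frac{\Gamma(a+1)}{\Gamma(a-b+1)\Gamma(b+1)}$ for $a\in\mathbb{C}$,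 $b\in\mathbb{Z}_{\ge0}$ (limit value at singularities). For $N\in\mathcal N$ let $H(N)=\{i\in H\mid N_i\ne0\}$ and $$P_i=-\sum_{j\in H}\nu_j(D^{-1})_{ji}-\sum_{j\in H}N_j(GD^{-1})_{ji},\qquad F_{ij}=\delta_{ij}P_j+(GD^{-1})_{ij}N_j,$$ $$K^\nu_{D,G}(w)=\sum_{N\in\mathcal N}\Bigl(\prod_{i\in H(N)}\binom{P_i+N_i}{N_i}\Bigr)w^N,\quad R^\nu_{D,G}(w)=\sum_{N\in\mathcal N}\Bigl(\det_{i,j\in H(N)}F_{ij}\Bigr)\Bigl(\prod_{i\in H(N)}\frac1{N_i}\binom{P_i+N_i-1}{N_i-1}\Bigr)w^N,$$ with empty determinants and products equal to $1$. *)

(* Defs.v *)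
From HB Require Import structures.
From mathcomp Require Import all_boot all_order all_algebra.
From mathcomp Require Import finmap monalg complex.
From mathcomp Require Import boolp classical_sets functions cardinality fsbigop.
From mathcomp Require Import filter reals ring.

Set Implicit Arguments.
Unset Strict Implicit.
Unset Printing Implicit Defensive.

Import Order.TTheory GRing.Theory Num.Theory.

Local Open Scope classical_set_scope.
Local Open Scope ring_scope.

(* The generalized binomial coefficient a (a - 1) ... (a - b + 1) / b!.  It is *)
(* a polynomial in a, so it takes at every a the limit value of the Gamma      *)
(* quotient, with which it agrees off the singularities by [gbinom_Gamma].     *)
Definition gbinom (K : fieldType) (a : K) (b : nat) : K :=
  (\prod_(k < b) (a - k%:R)) / b`!%:R.

Lemma gbinom_Gamma (K : numFieldType) (Gam : K -> K) (a : K) (b : nat) :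
  Gam 1 = 1 ->
  (forall z, (forall n : nat, z != - n%:R) -> Gam z != 0) ->
  (forall z, (forall n : nat, z != - n%:R) -> Gam (z + 1) = z * Gam z) ->
  (forall n : nat, a - b%:R + 1 != - n%:R) ->
  gbinom a b = Gam (a + 1) / (Gam (a - b%:R + 1) * Gam (b%:R + 1)).
Proof.
move=> Gam1 Gam_neq0 GamS ha.
have fact_Gam n : Gam (n%:R + 1) = n`!%:R.
  elim: n => [|n IHn]; first by rewrite add0r Gam1 fact0.
  rewrite GamS -natr1 ?IHn ?natr1 ?factS ?natrM // => m.
  by rewrite -subr_eq0 opprK -natrD pnatr_eq0.
have num c : (c <= b)%N ->
  Gam (a + 1) = (\prod_(k < c) (a - k%:R)) * Gam (a - c%:R + 1).
  elim: c => [|c IHc] lecb; first by rewrite big_ord0 mul1r subr0.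
  rewrite IHc 1?ltnW // big_ord_recr /= -mulrA; congr (_ * _).
  rewrite -natr1 opprD addrA subrK; apply: GamS => n.
  apply: contra_neq (ha (n + (b - c.+1))%N) => /eqP.
  rewrite subr_eq => /eqP->; rewrite natrD natrB // -natr1.
  by ring.
rewrite (num b) // fact_Gam /gbinom invfM mulrA; congr (_ / _).
by rewrite mulfK ?Gam_neq0.
Qed.

Section MultivariateSeries.
Context (H : choiceType) (K : fieldType).

(* The formal sums of a_N w^N over the monomials N, which are the elements of  *)
(* the projective limit of the rings K[[w_L]], L ranging over finite subsets.  *)
Record mseries := MSeries { mcoef :> {cmonom H} -> K }.

HB.instance Definition _ := gen_eqMixin mseries.
HB.instance Definition _ := gen_choiceMixin mseries.

Implicit Types (f g h : mseries) (N M A B : {cmonom H}).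

Lemma mseriesP f g : f =1 g -> f = g.
Proof. by case: f g => f [g] fg; congr MSeries; apply/funext. Qed.

Definition madd f g := MSeries (fun N => f N + g N).
Definition mopp f := MSeries (fun N => - f N).
Definition mconst (c : K) := MSeries (fun N => if N == mone then c else 0).
Definition mvar (i : H) := MSeries (fun N => (N == ucm i)%:R).
Definition mmult f g :=
  MSeries (fun N => \sum_(p \in [set p | mmul p.1 p.2 = N]) f p.1 * g p.2).

Lemma maddA : associative madd.
Proof. by move=> f g h; apply: mseriesP => N /=; rewrite addrA. Qed.
Lemma maddC : commutative madd.
Proof. by move=> f g; apply: mseriesP => N /=; rewrite addrC. Qed.
Lemma madd0 : left_id (mconst 0) madd.
Proof. by move=> f; apply: mseriesP => N /=; rewrite if_same add0r. Qed.
Lemma maddN : left_inverse (mconst 0) mopp madd.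
Proof. by move=> f; apply: mseriesP => N /=; rewrite if_same addNr. Qed.

HB.instance Definition _ := GRing.isZmodule.Build mseries maddA maddC madd0 maddN.

Lemma finite_mdivisors N : finite_set [set A | exists B, mmul A B = N].
Proof.
pose r (u : {ffun finsupp N -> 'I_(mdeg N).+1}) : {cmonom H} :=
  [cmonom (u i : nat) | i : finsupp N]%M.
apply: (@sub_finite_set _ _ (r @` setT)); last exact/finite_image/finite_finset.
move=> A /= [B AB].
have le_AN i : (A i <= N i)%N by rewrite -AB (mulcmE A B) leq_addr.
have le_N i : (N i <= mdeg N)%N.
  case: (mdomP N i) => // iN.
  by rewrite /mdeg (big_fsetD1 i) //= leq_addr.
exists [ffun i : finsupp N => inord (A (val i))] => //.
apply/eqP/cmP => i; rewrite /r cmE fsfun_ffun.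
case: insubP => [j _ <-|iN] /=.
  by rewrite ffunE inordK // ltnS (leq_trans (le_AN _)).
by have := le_AN i; rewrite (fsfun_dflt iN) leqn0 => /eqP.
Qed.

Definition mdivisors N : {fset {cmonom H}} :=
  fset_set [set A | exists B, mmul A B = N].

Lemma mdivisorsP N A : reflect (exists B, mmul A B = N) (A \in mdivisors N).
Proof.
by rewrite in_fset_set ?inE; [exact: asboolP|exact: finite_mdivisors].
Qed.

Lemma mmultE N f g M : (exists B, mmul M B = N) ->
  mmult f g M = \sum_(A <- mdivisors N) \sum_(B <- mdivisors N)
    if mmul A B == M then f A * g B else 0.
Proof.
move=> [C MC] /=; set S := mdivisors N.
pose r := [seq (A, B) | A <- S, B <- S].
have ur : uniq r by apply: allpairs_uniq; rewrite ?fset_uniq // => -[? ?] [? ?].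
have -> : [set p : {cmonom H} * {cmonom H} | mmul p.1 p.2 = M] =
  [set` r] `&` [set p | mmul p.1 p.2 = M].
  apply/seteqP; split => [[A B] /= AB|p []] //; split => //=.
  apply/allpairsP; exists (A, B); split => //=; apply/mdivisorsP.
    by exists (mmul B C); rewrite mulmA AB.
  by exists (mmul A C); rewrite mulmA (mulmC B) AB.
rewrite fsbig_mkcondr -fsbig_seq // big_allpairs.
apply: eq_bigr => A _; apply: eq_bigr => B _ /=.
by congr (if _ then _ else _); apply/idP/eqP => [/set_mem|/mem_set].
Qed.

Lemma mmultC : commutative mmult.
Proof.
move=> f g; apply: mseriesP => N.
rewrite !(@mmultE N) 1?exchange_big /=; last by exists mone; rewrite mulm1.
  apply: eq_bigr => A _; apply: eq_bigr => B _.
  by rewrite mulmC mulrC.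
by exists mone; rewrite mulm1.
Qed.

Lemma mmultA_subproof N A B C (x : K) :
  \sum_(M <- mdivisors N)
    (if (mmul A M == N) && (mmul B C == M) then x else 0) =
  if mmul A (mmul B C) == N then x else 0.
Proof.
case: (boolP (mmul B C \in mdivisors N)) => [BCN|/mdivisorsP BCN].
  rewrite (big_fsetD1 _ BCN) /= eqxx andbT big_seq big1 ?addr0 // => M.
  case/fsetD1P => /eqP MBC _; case: ifP => // /andP[_ /eqP BCM].
  by case: MBC.
rewrite ifF => [|]; last first.
  by apply: contra_notF BCN => /eqP ABC; exists A; rewrite mulmC.
rewrite big_seq big1 // => M MS; case: ifP => // /andP[_ /eqP BCM].
by case: BCN; apply/mdivisorsP; rewrite BCM.
Qed.

Lemma mmultA : associative mmult.
Proof.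
move=> f g h; apply: mseriesP => N.
have NN : exists B, mmul N B = N by exists mone; rewrite mulm1.
set S := mdivisors N.
transitivity (\sum_(A <- S) \sum_(B <- S) \sum_(C <- S)
   if mmul A (mmul B C) == N then f A * (g B * h C) else 0).
  rewrite (mmultE _ _ NN); apply: eq_bigr => A _.
  transitivity (\sum_(M <- S) \sum_(B <- S) \sum_(C <- S)
     if (mmul A M == N) && (mmul B C == M)
     then f A * (g B * h C) else 0).
    apply: eq_big_seq => M /mdivisorsP MS; rewrite (mmultE _ _ MS).
    case: eqP => _ /=; last by rewrite big1 // => B _; rewrite big1.
    rewrite mulr_sumr; apply: eq_bigr => B _; rewrite mulr_sumr.
    by apply: eq_bigr => C _; case: ifP => //; rewrite mulr0.
  rewrite exchange_big; apply: eq_bigr => B _.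
  rewrite exchange_big; apply: eq_bigr => C _ /=.
  exact: mmultA_subproof.
rewrite mmultC (mmultE _ _ NN).
transitivity (\sum_(C <- S) \sum_(M <- S) \sum_(A <- S) \sum_(B <- S)
     if (mmul C M == N) && (mmul A B == M)
     then f A * (g B * h C) else 0); last first.
  apply: eq_bigr => C _; apply: eq_big_seq => M /mdivisorsP MS.
  rewrite (mmultE _ _ MS).
  case: eqP => _ /=; last by rewrite big1 // => A _; rewrite big1.
  rewrite mulr_sumr; apply: eq_bigr => A _; rewrite mulr_sumr.
  apply: eq_bigr => B _; case: ifP => //; rewrite ?mulr0 // => _.
  by rewrite mulrA mulrC.
symmetry; under eq_bigr do rewrite exchange_big /=.
rewrite exchange_big /=; apply: eq_bigr => A _.
under eq_bigr do rewrite exchange_big /=.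
rewrite exchange_big /=; apply: eq_bigr => B _; apply: eq_bigr => C _.
by rewrite mmultA_subproof mulmC mulmA.
Qed.

Lemma finite_mpairs N :
  finite_set [set p : {cmonom H} * {cmonom H} | mmul p.1 p.2 = N].
Proof.
apply: (sub_finite_set _ (finite_setX (finite_mdivisors N) (finite_mdivisors N))).
by move=> [A B] /= AB; split; [exists B|exists A; rewrite mulmC].
Qed.

Lemma mmult1 : left_id (mconst 1) mmult.
Proof.
move=> f; apply: mseriesP => N /=.
rewrite (fsbigD1 (mone, N)) /=; [|exact: finite_mpairs|by rewrite mul1m].
rewrite eqxx mul1r fsbig1 ?addr0 // => -[A B] /= [AB nAB].
case: eqP => [A1|]; last by rewrite mul0r.
by case: nAB; rewrite -AB A1 mul1m.
Qed.

Lemma mmultDl : left_distributive mmult madd.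
Proof.
move=> f g h; apply: mseriesP => N /=.
rewrite -fsbig_split /=; last exact: finite_mpairs.
by apply: eq_fsbigr => p _; rewrite mulrDl.
Qed.

Lemma mone_neq0 : mconst 1 != mconst 0.
Proof.
by apply/eqP => /(congr1 (fun f => f mone)) /= /eqP; rewrite eqxx oner_eq0.
Qed.

HB.instance Definition _ := GRing.Zmodule_isComNzRing.Build mseries
  mmultA mmultC mmult1 mmultDl mone_neq0.

Lemma mcoef0 N : (0 : mseries) N = 0.
Proof. by rewrite /= if_same. Qed.

Lemma mcoefD f g N : (f + g) N = f N + g N.
Proof. by []. Qed.

Lemma mcoefB f g N : (f - g) N = f N - g N.
Proof. by []. Qed.

Lemma mcoef1 N : (1 : mseries) N = (N == mone)%:R.
Proof. by rewrite /=; case: eqP. Qed.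

Lemma mcoefM f g N : (f * g) N =
  \sum_(p \in [set p | mmul p.1 p.2 = N]) f p.1 * g p.2.
Proof. by []. Qed.

Lemma mcoef_sum (I : Type) (r : seq I) (P : pred I) (F : I -> mseries) N :
  (\sum_(i <- r | P i) F i) N = \sum_(i <- r | P i) F i N.
Proof. by apply: (big_morph (fun f => f N)) => //; exact: mcoef0. Qed.

Lemma mcoefM1 f g : (f * g) mone = f mone * g mone.
Proof.
rewrite mcoefM (_ : [set p | _] = [set (mone, mone)]) ?fsbig_set1 //.
apply/seteqP; split => [[A B] /= /eqP|p -> /=]; last by rewrite mul1m.
by rewrite cmM_eq1 => /andP[/eqP-> /eqP->].
Qed.

Lemma mcoef_constM c f N : (mconst c * f) N = c * f N.
Proof.
rewrite mcoefM (fsbigD1 (mone, N)) /=; [|exact: finite_mpairs|by rewrite mul1m].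
rewrite eqxx fsbig1 ?addr0 // => -[A B] /= [AB nAB].
case: eqP => [A1|]; last by rewrite mul0r.
by case: nAB; rewrite -AB A1 mul1m.
Qed.

Lemma mcoef_exp_lt h k N : h mone = 0 -> (mdeg N < k)%N -> (h ^+ k) N = 0.
Proof.
move=> h0; elim: k N => // k IHk N ltNk.
rewrite exprS mcoefM fsbig1 // => -[A B] /= AB.
have [A1|A1] := eqVneq A mone; first by rewrite A1 h0 mul0r.
rewrite IHk ?mulr0 //; move: ltNk; rewrite -AB mdegM ltnS; apply: leq_trans.
by rewrite -[X in (X < _)%N]add0n ltn_add2r lt0n mdeg_eq0.
Qed.

(* The series obtained by substituting h in the univariate power series with   *)
(* coefficients a.  When h has no constant term, h ^+ k has no term of degree  *)
(* less than k, so that the terms left out do not contribute.                  *)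
Definition msubst (a : nat -> K) h :=
  MSeries (fun N => \sum_(k < (mdeg N).+1) a k * (h ^+ k) N).

Lemma msubstE a h N n : h mone = 0 -> (mdeg N <= n)%N ->
  msubst a h N = \sum_(k < n.+1) a k * (h ^+ k) N.
Proof.
move=> h0 leNn; rewrite /= -!(big_mkord xpredT (fun k => a k * (h ^+ k) N)).
rewrite [RHS](@big_cat_nat _ _ _ (mdeg N).+1) //= [X in _ = _ + X]big_nat.
rewrite [X in _ = _ + X]big1 ?addr0 // => k /andP[? _].
by rewrite mcoef_exp_lt ?mulr0.
Qed.

Lemma mgeomE h : h mone = 0 -> msubst (fun=> 1) h * (1 - h) = 1.
Proof.
move=> h0; apply: mseriesP => N.
transitivity (((\sum_(k < (mdeg N).+1) h ^+ k) * (1 - h)) N).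
  rewrite !mcoefM; apply: eq_fsbigr => -[A B] /set_mem AB; congr (_ * _).
  rewrite (@msubstE _ _ _ (mdeg N)) ?mcoef_sum //; last first.
    by rewrite -AB mdegM leq_addr.
  by apply: eq_bigr => k _; rewrite mul1r.
rewrite mulrC -opprB mulNr -subrX1 opprB mcoefB mcoef_exp_lt ?subr0 //.
Qed.

Definition munit : pred mseries := fun f => f mone != 0.

Definition minv f : mseries := if munit f then
  mconst (f mone)^-1 * msubst (fun=> 1) (1 - mconst (f mone)^-1 * f) else f.

Lemma mmultV : {in munit, left_inverse 1 minv *%R}.
Proof.
move=> f uf; rewrite /minv [munit f]uf mulrAC mulrC.
rewrite -[X in _ * X](subKr 1) mgeomE //.
by rewrite mcoefB mcoef_constM mcoef1 eqxx mulVf ?subrr.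
Qed.

Lemma munitPl f g : g * f = 1 -> munit f.
Proof.
move=> /(congr1 (fun h : mseries => h mone)); rewrite mcoefM1 mcoef1 eqxx => gf1.
by apply/eqP => f0; move/eqP: gf1; rewrite f0 mulr0 eq_sym oner_eq0.
Qed.

Lemma minv_out : {in [predC munit], minv =1 id}.
Proof. by move=> f nf; rewrite /minv ifF //; exact/negbTE. Qed.

HB.instance Definition _ :=
  GRing.ComNzRing_hasMulInverse.Build mseries mmultV munitPl minv_out.

(* f ^ a = (1 + (f - 1)) ^ a by the binomial series; meant for f with constant *)
(* term 1.                                                                     *)
Definition mpow f (a : K) : mseries := msubst (gbinom a) (f - 1).

(* Convergence in the projective limit of the rings K[[w_L]]: for every finite *)
(* L and every d, eventual equality modulo the ideal of K[[w_L]] spanned by    *)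
(* the monomials of degree at least d, after setting w_i = 0 outside L.        *)
Definition mcvg (u : nat -> mseries) f : Prop :=
  forall (L : {fset H}) (d : nat), \forall n \near \oo,
    forall N, (finsupp N `<=` L)%fset -> (mdeg N < d)%N -> u n N = f N.

(* Convergence irrespective of the order of the factors, H being countably     *)
(* infinite: every bijection from nat to H gives convergent partial products,  *)
(* with the same limit.                                                        *)
Definition mprod_cvg_to (F : H -> mseries) f : Prop :=
  forall s : nat -> H, bijective s -> mcvg (fun n => \prod_(k < n) F (s k)) f.

Definition mprod_cvg (F : H -> mseries) : Prop := exists f, mprod_cvg_to F f.

(* The infinite product, with the junk value 1 when it does not converge.      *)
Definition mprod (F : H -> mseries) : mseries := xget 1 (mprod_cvg_to F).

Implicit Types (D Dinv G : H -> H -> K) (Q : H -> mseries) (nu : H -> K).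

Definition imx_mul_def D G : Prop :=
  forall i j, finite_set [set k | D i k * G k j != 0].

Definition imx_mul D G : H -> H -> K :=
  fun i j => \sum_(k \in [set: H]) D i k * G k j.

Definition imx_inverse D Dinv : Prop :=
  [/\ imx_mul_def D Dinv, forall i j, imx_mul D Dinv i j = (i == j)%:R,
      imx_mul_def Dinv D & forall i j, imx_mul Dinv D i j = (i == j)%:R].

Definition Qsystem_solution D G Q : Prop :=
  (forall i, Q i mone = 1) /\
  forall i, [/\ mprod_cvg (fun j => mpow (Q j) (D i j)),
    mprod_cvg (fun j => mpow (Q j) (G i j)) &
    mprod (fun j => mpow (Q j) (D i j)) +
      mvar i * mprod (fun j => mpow (Q j) (G i j)) = 1].

Definition canonical_solution D Dinv G Q : Prop :=
  Qsystem_solution D G Q /\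
  forall i,
    (forall j, mprod_cvg (fun k => mpow (Q k) (Dinv i j * D j k))) /\
    mprod_cvg_to
      (fun j => mprod (fun k => mpow (Q k) (Dinv i j * D j k))) (Q i).

Definition nu_set Dinv : set (H -> K) :=
  [set nu | forall i, finite_set [set j | nu j * Dinv j i != 0]].

Definition Qnu Q nu : mseries := mprod (fun i => mpow (Q i) (nu i)).

Definition Pnu Dinv G nu N (i : H) : K :=
  - (\sum_(j \in [set: H]) nu j * Dinv j i)
  - (\sum_(j <- finsupp N) (N j)%:R * imx_mul G Dinv j i).

Definition Fnu Dinv G nu N (i j : H) : K :=
  (i == j)%:R * Pnu Dinv G nu N j + imx_mul G Dinv i j * (N j)%:R.

(* The determinant of a matrix indexed by a finite set; it does not depend on  *)
(* the enumeration.                                                            *)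
Definition fset_det (S : {fset H}) (F : H -> H -> K) : K :=
  \det (\matrix_(a < #|` S|, b < #|` S|)
          F (tnth (in_tuple (enum_fset S)) a) (tnth (in_tuple (enum_fset S)) b)).

Definition Kseries Dinv G nu : mseries := MSeries (fun N =>
  \prod_(i <- finsupp N) gbinom (Pnu Dinv G nu N i + (N i)%:R) (N i)).

Lemma Kseries_unit Dinv G nu : Kseries Dinv G nu \is a GRing.unit.
Proof.
by rewrite unfold_in /= /munit /= mdom1 big_seq_fset0 oner_eq0.
Qed.

Definition Rseries Dinv G nu : mseries := MSeries (fun N =>
  fset_det (finsupp N) (Fnu Dinv G nu N) *
  \prod_(i <- finsupp N)
    ((N i)%:R^-1 * gbinom (Pnu Dinv G nu N i + (N i)%:R - 1) (N i).-1)).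

End MultivariateSeries.

(* Main.v *)
Require Import Defs.
From mathcomp Require Import all_boot all_order all_algebra all_fingroup.
From mathcomp Require Import finmap monalg complex.
From mathcomp Require Import boolp classical_sets functions cardinality fsbigop.
From mathcomp Require Import filter reals ring.

Set Implicit Arguments.
Unset Strict Implicit.
Unset Printing Implicit Defensive.

Import Order.TTheory GRing.Theory Num.Theory.

Local Open Scope classical_set_scope.
Local Open Scope ring_scope.

(** Put [U_i = prod_j Q_j^(D_ij)] and [A = G D^-1].  The equation of the system
    reads [U_i = 1 - w_i (...)], so [U_i] is 1 wherever [w_i] is set to 0; modulo
    the variables outside a finite set, products of powers of the [U_i] are
    therefore finite, and may be rearranged freely.  Being canonical means
    [Q_i = prod_j U_j^(D^-1)_ij].  Hence, with [mu_j = sum_i nu_i (D^-1)_ij] and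
    [W(mu) = prod_j U_j^(mu_j)], the product [Q^nu] converges to [W(mu)]
    ([Qnu_cvg]); for [nu] the [i]-th row of [G] this turns the system into
    [U_i + w_i W(A_i) = 1], the standard system with [D] the identity
    ([Qprod_standard]).

    For the standard system no inversion formula is needed.  Since
    [U_i W(mu) = W(mu + e_i)], multiplying the [i]-th equation by [W(mu)] gives
    [X(mu) - X(mu + e_i) = w_i X(mu + A_i)] for [X = W].  The two series of the
    theorem satisfy the same recurrence, by Pascal's rule: factor by factor for
    [K] ([Qfamily_K]), and row by row for [R], once the binomial factors have
    been moved inside the determinant ([Qfamily_R]).

    The recurrence determines [X] from [X(0)] ([Qfamily_inj]).  Indeed, if two
    solutions agree in degrees below that of [N] for all [mu], then the right-hand
    sides agree at [N], so that the difference of the [N]-th coefficients is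
    invariant under [mu -> mu + e_i]; as it is a polynomial in the finitely many
    [mu_i] with [i] in the support of [N], it is a constant, namely its value
    at 0.  Now [K(mu)] and [K(0) W(mu)] agree at [mu = 0] because [W(0) = 1], and
    so do [W(mu)] and [R(mu)] because [R(0) = 1]: for [mu = 0] and [N <> 1] the
    vector [N] is in the kernel of the matrix ([Rmu0]).

    Polynomiality in the exponents also yields the laws of powers, as they hold
    for natural exponents. *)

(** * Polynomial functions *)

Section PolynomialFunctions.
Context (K : numFieldType).
Implicit Types (f g : K -> K) (a : K).

Definition polyfun f := exists p : {poly K}, forall t, f t = p.[t].

Lemma polyfun_cst a : polyfun (fun=> a).
Proof. by exists a%:P => t; rewrite hornerC. Qed.

Lemma polyfun_id : polyfun id.
Proof. by exists 'X => t; rewrite hornerX. Qed.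

Lemma polyfunD f g : polyfun f -> polyfun g -> polyfun (fun t => f t + g t).
Proof. by case=> p fp [q gq]; exists (p + q) => t; rewrite hornerD fp gq. Qed.

Lemma polyfunM f g : polyfun f -> polyfun g -> polyfun (fun t => f t * g t).
Proof. by case=> p fp [q gq]; exists (p * q) => t; rewrite hornerM fp gq. Qed.

Lemma polyfunN f : polyfun f -> polyfun (fun t => - f t).
Proof. by case=> p fp; exists (- p) => t; rewrite hornerN fp. Qed.

Lemma polyfunB f g : polyfun f -> polyfun g -> polyfun (fun t => f t - g t).
Proof. by move=> pf pg; apply/polyfunD/polyfunN. Qed.

Lemma polyfun_sum (I : Type) (r : seq I) (P : pred I) (F : I -> K -> K) :
  (forall i, polyfun (F i)) -> polyfun (fun t => \sum_(i <- r | P i) F i t).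
Proof.
move=> /choice[p Fp]; exists (\sum_(i <- r | P i) p i) => t.
by rewrite horner_sum; apply: eq_bigr.
Qed.

Lemma polyfun_prod (I : Type) (r : seq I) (P : pred I) (F : I -> K -> K) :
  (forall i, polyfun (F i)) -> polyfun (fun t => \prod_(i <- r | P i) F i t).
Proof.
move=> /choice[p Fp]; exists (\prod_(i <- r | P i) p i) => t.
by rewrite horner_prod; apply: eq_bigr.
Qed.

Lemma polyfun_gbinom f n : polyfun f -> polyfun (fun t => gbinom (f t) n).
Proof.
move=> pf; apply: polyfunM; last exact: polyfun_cst.
by apply: polyfun_prod => i; apply/polyfunB/polyfun_cst.
Qed.

Lemma polyfun_det n (F : K -> 'M[K]_n) :
  (forall i j, polyfun (fun t => F t i j)) -> polyfun (fun t => \det (F t)).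
Proof.
move=> pF; apply: polyfun_sum => s.
by apply: polyfunM; [exact: polyfun_cst|apply: polyfun_prod].
Qed.

Lemma polyfun_eq f g : polyfun f -> polyfun g ->
  (forall n : nat, f n%:R = g n%:R) -> forall t, f t = g t.
Proof.
move=> [p fp] [q gq] fg t; rewrite fp gq; congr (_.[t]).
apply/eqP; rewrite -subr_eq0; apply/negPn/negP; set d := p - q => nz.
pose s := [seq (n%:R : K) | n <- iota 0 (size d)].
have : (size s < size d)%N.
  apply: max_poly_roots => //.
    apply/allP => _ /mapP[n _ ->].
    by rewrite rootE hornerD hornerN -fp -gq fg subrr.
  by rewrite map_inj_uniq ?iota_uniq //; exact: mulrIn (oner_neq0 _).
by rewrite size_map size_iota ltnn.
Qed.

(** In characteristic 0 only the constant polynomials are periodic: the values at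
    the natural numbers all coincide. *)
Lemma polyfun_periodic f : polyfun f -> (forall t, f (t + 1) = f t) ->
  forall t, f t = f 0.
Proof.
move=> pf f1; apply: polyfun_eq => // [|n]; first exact: polyfun_cst.
by elim: n => // n IHn; rewrite -natr1 f1.
Qed.

End PolynomialFunctions.

(** * Generalized binomial coefficients *)

Section GeneralizedBinomial.
Context (K : numFieldType).
Implicit Type a : K.

Lemma gbinom0 a : gbinom a 0 = 1.
Proof. by rewrite /gbinom big_ord0 fact0 divr1. Qed.

Lemma gbinom_absorb a n : n.+1%:R * gbinom a n.+1 = (a - n%:R) * gbinom a n.
Proof.
rewrite /gbinom big_ord_recr /= factS natrM.
have n1 : (n.+1%:R : K) != 0 by rewrite pnatr_eq0.
have nf : (n`!%:R : K) != 0 by rewrite pnatr_eq0 -lt0n fact_gt0.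
by field; rewrite nf nat1r n1.
Qed.

Lemma gbinom_pascal a n : gbinom (a + 1) n.+1 = gbinom a n.+1 + gbinom a n.
Proof.
have n1 : (n.+1%:R : K) != 0 by rewrite pnatr_eq0.
apply: (mulfI n1); rewrite mulrDr !gbinom_absorb -mulrDl -natr1.
have -> : a - n%:R + (n%:R + 1) = a + 1 by ring.
have -> : a + 1 - n%:R = a - n%:R + 1 by ring.
rewrite /gbinom mulrA mulrA; congr (_ / _).
have : (a + 1) * \prod_(k < n) (a - k%:R) =
   \prod_(k < n.+1) (a + 1 - k%:R).
  rewrite big_ord_recl subr0; congr (_ * _); apply: eq_bigr => i _.
  by rewrite lift0 -natr1; ring.
by rewrite big_ord_recr /= => ->; ring.
Qed.

Lemma gbinom_nat m n : gbinom (m%:R : K) n = 'C(m, n)%:R.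
Proof.
elim: m n => [|m IHm] [|n]; rewrite ?gbinom0 ?bin0 //.
  by rewrite /gbinom big_ord_recl subrr mul0r mul0r bin0n.
by rewrite -natr1 gbinom_pascal !IHm binS natrD.
Qed.

End GeneralizedBinomial.

(** * Congruences between series *)

Section Congruences.
Context (H : choiceType) (K : fieldType).
Implicit Types (f g : mseries H K) (N M : {cmonom H}) (L : {fset H}) (d : nat).

(** Congruence modulo the ideal spanned by the monomials that involve a variable
    outside [L] or have degree at least [d]; these are the neighbourhoods that
    define the convergence [mcvg]. *)
Definition eqmod L d f g :=
  forall N, (finsupp N `<=` L)%fset -> (mdeg N < d)%N -> f N = g N.

Lemma eqmod_refl L d f : eqmod L d f f. Proof. by []. Qed.

Lemma eqmod_sym L d f g : eqmod L d f g -> eqmod L d g f.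
Proof. by move=> fg N *; rewrite fg. Qed.

Lemma eqmod_trans L d f g h : eqmod L d f g -> eqmod L d g h -> eqmod L d f h.
Proof. by move=> fg gh N *; rewrite fg ?gh. Qed.

Lemma eqmodM L d f f' g g' :
  eqmod L d f f' -> eqmod L d g g' -> eqmod L d (f * g) (f' * g').
Proof.
move=> ff' gg' N NL Nd; rewrite !mcoefM; apply: eq_fsbigr => -[A B] /set_mem /= AB.
move: NL Nd; rewrite -AB mdomD mdegM fsubUset => /andP[AL BL] Nd.
by rewrite ff' ?gg' // (leq_ltn_trans _ Nd) ?leq_addr ?leq_addl.
Qed.

Lemma eqmod_prod L d (I : eqType) (r : seq I) (F G : I -> mseries H K) :
  (forall i, i \in r -> eqmod L d (F i) (G i)) ->
  eqmod L d (\prod_(i <- r) F i) (\prod_(i <- r) G i).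
Proof.
elim: r => [|i r IHr] FG; first by rewrite !big_nil.
rewrite !big_cons; apply: eqmodM; first by apply: FG; rewrite mem_head.
by apply: IHr => j jr; apply: FG; rewrite in_cons jr orbT.
Qed.

Lemma eqmodX L d f g k : eqmod L d f g -> eqmod L d (f ^+ k) (g ^+ k).
Proof.
by move=> fg; elim: k => // k IHk; rewrite !exprS; apply: eqmodM.
Qed.

Lemma eqmod_mpow L d f g a : eqmod L d f g -> eqmod L d (mpow f a) (mpow g a).
Proof.
move=> fg N NL Nd; apply: eq_bigr => k _; congr (_ * _).
by apply: (@eqmodX L d) => // M ML Md; rewrite !mcoefB fg.
Qed.

Lemma eqmod_eq f g : (forall L d, eqmod L d f g) -> f = g.
Proof. by move=> fg; apply: mseriesP => N; apply: (fg (finsupp N) (mdeg N).+1). Qed.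

Lemma mcoef_varM i f M : (mvar K i * f) (mmul (ucm i) M) = f M.
Proof.
rewrite mcoefM (fsbigD1 (ucm i, M)) //=; last exact: finite_mpairs.
rewrite eqxx mul1r fsbig1 ?addr0 // => -[A B] /= [AB nAB].
case: eqP => [A1|]; last by rewrite mul0r.
case: nAB; rewrite A1; congr (_, _); apply/eqP/cmP => j.
by move: AB => /(congr1 (fun N : {cmonom H} => N j)); rewrite A1 !cmM => /addnI.
Qed.

Lemma mcoef_varM0 i f N : N i = 0%N -> (mvar K i * f) N = 0.
Proof.
move=> Ni; rewrite mcoefM fsbig1 // => -[A B] /= AB.
case: eqP => [A1|]; last by rewrite mul0r.
by move: Ni; rewrite -AB A1 cmM cmUU.
Qed.

(** With [mcoef_varM] and [mcoef_varM0], this computes every coefficient of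
    [w_i f]. *)
Lemma ucm_dvd i N : N i != 0%N -> exists M, N = mmul (ucm i) M.
Proof.
move=> Ni; exists (divcm N (ucm i)); apply/eqP/cmP => j.
rewrite cmM divcmE cmU subnKC //.
by case: eqP => // <-; rewrite lt0n.
Qed.

End Congruences.

(** * Laws of powers of series *)

Section Powers.
Context (H : choiceType) (K : numFieldType).
Implicit Types (f g : mseries H K) (N M : {cmonom H}) (a b : K).

(** The degree in [t] of a coefficient may grow with the monomial. *)
Definition polyser (F : K -> mseries H K) := forall N, polyfun (fun t => F t N).

Lemma polyser_cst f : polyser (fun=> f).
Proof. by move=> N; exact: polyfun_cst. Qed.

Lemma polyserM F G : polyser F -> polyser G -> polyser (fun t => F t * G t).
Proof.
move=> pF pG N.
have -> : (fun t => (F t * G t) N) = fun t =>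
    \sum_(p <- fset_set [set p | mmul p.1 p.2 = N]) F t p.1 * G t p.2.
  by apply/funext => t; rewrite mcoefM fsbig_finite //; exact: finite_mpairs.
by apply: polyfun_sum => p; apply: polyfunM.
Qed.

Lemma polyser_prod (I : Type) (r : seq I) (F : I -> K -> mseries H K) :
  (forall i, polyser (F i)) -> polyser (fun t => \prod_(i <- r) F i t).
Proof.
move=> pF; elim: r => [|i r IHr].
  by under eq_fun do rewrite big_nil; exact: polyser_cst.
by under eq_fun do rewrite big_cons; exact: polyserM.
Qed.

Lemma polyser_mpow f (p : K -> K) : polyfun p -> polyser (fun t => mpow f (p t)).
Proof.
move=> pp N; apply: polyfun_sum => k.
by apply: polyfunM; [exact: polyfun_gbinom|exact: polyfun_cst].
Qed.

(** Reduces identities between powers with arbitrary exponents to natural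
    exponents, where they are identities in a commutative ring. *)
Lemma polyser_eq F G : polyser F -> polyser G ->
  (forall n : nat, F n%:R = G n%:R) -> forall t, F t = G t.
Proof.
move=> pF pG FG t; apply: mseriesP => N.
by apply: (polyfun_eq (pF N) (pG N)) => n; rewrite FG.
Qed.

Lemma mpow_mone f a : mpow f a mone = 1.
Proof. by rewrite /= mdeg1 big_ord1 gbinom0 mul1r /= eqxx. Qed.

(** This is the binomial theorem for [f = 1 + h]; both sums are extended to a
    common range that contains [n] and the degree of the monomial. *)
Lemma mpow_nat f n : f mone = 1 -> mpow f n%:R = f ^+ n.
Proof.
move=> f1; apply: mseriesP => N; set h := f - 1.
have h0 : h mone = 0 by rewrite mcoefB f1 mcoef1 eqxx subrr.
rewrite [LHS](@msubstE _ _ _ _ _ (n + mdeg N)%N h0) ?leq_addl //.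
have -> : f = 1 + h by rewrite addrC subrK.
rewrite exprDn mcoef_sum (big_ord_widen (n + mdeg N).+1
  (fun i => (1 ^+ (n - i) * h ^+ i *+ 'C(n, i)) N)) ?ltnS ?leq_addr //.
rewrite [RHS]big_mkcond /=; apply: eq_bigr => i _.
rewrite gbinom_nat expr1n mul1r; case: ltnP => ni; last first.
  by rewrite bin_small ?mul0r.
elim: 'C(n, i) => [|k IHk]; first by rewrite mul0r mulr0n mcoef0.
by rewrite -natr1 mulrDl mul1r IHk mulrSr mcoefD.
Qed.

Lemma mpowD f a b : f mone = 1 -> mpow f (a + b) = mpow f a * mpow f b.
Proof.
(* Both sides are polynomial in each exponent, so [b] and then [a] may be *)
(* taken natural.                                                         *)
move=> f1; move: a b; have pI := @polyfun_id K; have pC := @polyfun_cst K.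
suff nat_b a n : mpow f (a + n%:R) = mpow f a * mpow f n%:R.
  move=> a; apply: polyser_eq => [||n]; last exact: nat_b.
    by apply: polyser_mpow; apply: polyfunD.
  by apply: polyserM; [exact: polyser_cst|exact: polyser_mpow].
move: a; apply: polyser_eq => [||m].
- by apply: polyser_mpow; apply: polyfunD.
- by apply: polyserM; [exact: polyser_mpow|exact: polyser_cst].
- by rewrite -natrD !mpow_nat // exprD.
Qed.

Lemma mpow0 f : f mone = 1 -> mpow f 0 = 1.
Proof. by move=> f1; rewrite (mpow_nat 0 f1) expr0. Qed.

Lemma mpow1 f : f mone = 1 -> mpow f 1 = f.
Proof. by move=> f1; rewrite (mpow_nat 1 f1) expr1. Qed.

Lemma mpow1l a : mpow (1 : mseries H K) a = 1.
Proof.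
move: a; apply: polyser_eq => [||n]; last by rewrite mpow_nat ?expr1n // mcoef1 eqxx.
  by apply: polyser_mpow; exact: polyfun_id.
exact: polyser_cst.
Qed.

Lemma mpowMl f g a : f mone = 1 -> g mone = 1 ->
  mpow (f * g) a = mpow f a * mpow g a.
Proof.
move=> f1 g1; move: a; apply: polyser_eq => [||n].
- by apply: polyser_mpow; exact: polyfun_id.
- by apply: polyserM; apply: polyser_mpow; exact: polyfun_id.
- by rewrite !mpow_nat ?exprMn // mcoefM1 f1 g1 mulr1.
Qed.

Lemma mpowM f a b : f mone = 1 -> mpow (mpow f a) b = mpow f (a * b).
Proof.
move=> f1; move: b; apply: polyser_eq => [||n].
- by apply: polyser_mpow; exact: polyfun_id.
- by apply/polyser_mpow/polyfunM; [exact: polyfun_cst|exact: polyfun_id].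
- rewrite mpow_nat ?mpow_mone //.
  elim: n => [|n IHn]; first by rewrite expr0 mulr0 mpow0.
  by rewrite exprSr IHn -natr1 mulrDr mulr1 mpowD.
Qed.

Lemma mcoef1_prod (I : Type) (r : seq I) (F : I -> mseries H K) :
  (forall i, F i mone = 1) -> (\prod_(i <- r) F i) mone = 1.
Proof.
move=> F1; elim: r => [|i r IHr]; first by rewrite big_nil mcoef1 eqxx.
by rewrite big_cons mcoefM1 F1 IHr mulr1.
Qed.

Lemma mpow_prod (I : Type) (r : seq I) (F : I -> mseries H K) a :
  (forall i, F i mone = 1) ->
  mpow (\prod_(i <- r) F i) a = \prod_(i <- r) mpow (F i) a.
Proof.
move=> F1; elim: r => [|i r IHr]; first by rewrite !big_nil mpow1l.
by rewrite !big_cons mpowMl ?IHr //; exact: mcoef1_prod.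
Qed.

Lemma mpow_sum (I : Type) (r : seq I) (c : I -> K) f : f mone = 1 ->
  \prod_(i <- r) mpow f (c i) = mpow f (\sum_(i <- r) c i).
Proof.
move=> f1; elim: r => [|i r IHr]; first by rewrite !big_nil mpow0.
by rewrite !big_cons IHr mpowD.
Qed.

End Powers.

(** * The recurrence in the exponents *)

Section Families.
Context (H : choiceType) (K : numFieldType) (A : H -> H -> K).
Implicit Types (mu : H -> K) (X Y : (H -> K) -> mseries H K) (N M : {cmonom H}).

Definition shift mu (i : H) (t : K) : H -> K := fun j => mu j + t * (i == j)%:R.

(** The recurrence shared by [W(mu)], [K(mu)] and [R(mu)], with the regularity
    in [mu] under which it has at most one solution for a given value at 0. *)
Record Qfamily X : Prop := {
  Qfamily_rec : forall mu i, X mu - X (shift mu i 1) = mvar K i * X (mu \+ A i);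
  Qfamily_local : forall N mu mu',
    {in finsupp N, mu =1 mu'} -> X mu N = X mu' N;
  Qfamily_poly : forall mu i, polyser (fun t => X (shift mu i t)) }.

Lemma Qfamily_mull c X : Qfamily X -> Qfamily (fun mu => c * X mu).
Proof.
case=> rX lX pX; split=> [mu i|N mu mu' eq_mu|mu i].
- by rewrite -mulrBr rX mulrCA.
- rewrite !mcoefM; apply: eq_fsbigr => -[B C] /set_mem /= BC; congr (_ * _).
  by apply: lX => i iC; apply: eq_mu; rewrite -BC mdomD in_fsetU iC orbT.
- by apply: polyserM; [exact: polyser_cst|exact: pX].
Qed.

(** Induction on the degree of the monomial: by the recurrence the difference of
    the coefficients is invariant under unit shifts of [mu], hence constant since
    it is polynomial, and the finitely many coordinates of [mu] that matter can be
    moved to 0 one at a time. *)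
Lemma Qfamily_inj X Y : Qfamily X -> Qfamily Y ->
  X (fun=> 0) = Y (fun=> 0) -> forall mu, X mu = Y mu.
Proof.
move=> [rX lX pX] [rY lY pY] XY0 mu; apply: mseriesP => N.
have [n] := ubnP (mdeg N); elim: n N mu => // n IHn N mu ltNn.
pose f nu := X nu N - Y nu N.
have f1 nu i : f (shift nu i 1) = f nu.
  suff : (X nu - X (shift nu i 1)) N = (Y nu - Y (shift nu i 1)) N.
    rewrite !mcoefB /f => /(congr1 (fun x => x + X (shift nu i 1) N)).
    by rewrite subrK => ->; ring.
  rewrite rX rY; have [Ni|/ucm_dvd[M NM]] := eqVneq (N i) 0%N.
    by rewrite !mcoef_varM0.
  rewrite NM !mcoef_varM; apply: IHn.
  by move: ltNn; rewrite NM mdegM mdegU.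
have ft nu i t : f (shift nu i t) = f nu.
  have -> : f nu = f (shift nu i 0).
    by congr f; apply/funext => j; rewrite /shift mul0r addr0.
  move: t; apply: polyfun_periodic => [|t].
    by apply: polyfunB; [exact: pX|exact: pY].
  rewrite -(f1 (shift nu i t) i); congr f; apply/funext => j.
  by rewrite /shift mulrDl addrA.
have fs (s : seq H) : f (fun j => if j \in s then 0 else mu j) = f mu.
  elim: s => [|i s IHs]; first by congr f; apply/funext.
  pose nu j := if j \in s then 0 else mu j.
  rewrite -IHs -(ft nu i (- nu i)); congr f; apply/funext => j.
  rewrite /shift inE eq_sym /nu; case: eqP => [<-|_] /=.
    by rewrite mulr1 subrr.
  by rewrite mulr0 addr0.
apply/eqP; rewrite -subr_eq0 -/(f mu) -(fs (finsupp N)) /f.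
rewrite (lX N _ (fun=> 0)) ?(lY N _ (fun=> 0)) ?XY0 ?subrr // => j jN.
  by rewrite jN.
by rewrite jN.
Qed.

(** The [P_j] of the theorem as a function of [mu = nu D^-1] and [A = G D^-1]. *)
Definition Pmu mu N (j : H) : K :=
  - mu j - \sum_(i <- finsupp N) (N i)%:R * A i j.

Lemma PmuE mu N (L : {fset H}) j : (finsupp N `<=` L)%fset ->
  Pmu mu N j = - mu j - \sum_(i <- L) (N i)%:R * A i j.
Proof.
move=> NL; congr (_ - _); apply: big_fset_incl => // i _.
by rewrite -cmE_eq0 => /eqP ->; rewrite mul0r.
Qed.

(** Adding [A_i] to [mu] makes up for dropping one factor [w_i] of the monomial;
    hence both sides of the recurrence involve the same [P_j]. *)
Lemma Pmu_varM mu M i : Pmu mu (mmul (ucm i) M) =1 Pmu (mu \+ A i) M.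
Proof.
move=> j; set N := mmul _ _; set L := finsupp N.
have ML : (finsupp M `<=` L)%fset by rewrite /L mdomD fsubsetUr.
have iL : i \in L by rewrite /L mdomD mdomU in_fsetU in_fset1 eqxx.
rewrite (PmuE _ _ (fsubset_refl L)) (PmuE _ _ ML).
under eq_bigr => k _ do rewrite cmM natrD mulrDl cmU.
rewrite big_split /= opprD addrA opprD; congr (_ - _ - _).
rewrite (big_fsetD1 i) //= eqxx mul1r big_seq big1 ?addr0 // => k.
by rewrite in_fsetD1 eq_sym => /andP[/negbTE-> _]; rewrite mul0r.
Qed.

Lemma Pmu_shift mu i t N j :
  Pmu (shift mu i t) N j = Pmu mu N j - t * (i == j)%:R.
Proof. by rewrite /Pmu /shift opprD addrAC. Qed.

Lemma polyfun_Pmu mu i N j : polyfun (fun t => Pmu (shift mu i t) N j).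
Proof.
under eq_fun do rewrite Pmu_shift.
apply: polyfunB; first exact: polyfun_cst.
by apply: polyfunM; [exact: polyfun_id|exact: polyfun_cst].
Qed.

Definition Kmu mu : mseries H K := MSeries (fun N =>
  \prod_(j <- finsupp N) gbinom (Pmu mu N j + (N j)%:R) (N j)).

(** Lets the two monomials of the recurrence, whose supports may differ, be
    treated over a common index set. *)
Lemma KmuE mu N (L : {fset H}) : (finsupp N `<=` L)%fset ->
  Kmu mu N = \prod_(j <- L) gbinom (Pmu mu N j + (N j)%:R) (N j).
Proof.
move=> NL; apply: big_fset_incl => // i _.
by rewrite -cmE_eq0 => /eqP ->; rewrite gbinom0.
Qed.

Lemma Kmu_local N mu mu' :
  {in finsupp N, mu =1 mu'} -> Kmu mu N = Kmu mu' N.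
Proof. by move=> e; apply: eq_big_seq => j jN; rewrite /Pmu e. Qed.

Lemma shift_local mu i t N : N i = 0%N ->
  {in finsupp N, mu =1 shift mu i t}.
Proof.
move=> Ni j jN; rewrite /shift; case: eqP => [ij|_]; last by rewrite mulr0 addr0.
by move: jN; rewrite -ij -cmE_neq0 Ni.
Qed.

(** A unit shift of [mu_i] changes only the [i]-th factor, where it lowers [P_i]
    by 1; the recurrence is then Pascal's rule for that factor. *)
Lemma Qfamily_K : Qfamily Kmu.
Proof.
split=> [mu i| |mu i N]; last 2 first.
- exact: Kmu_local.
- apply: polyfun_prod => j; apply: polyfun_gbinom; apply: polyfunD.
    exact: polyfun_Pmu.
  exact: polyfun_cst.
apply: mseriesP => N; rewrite mcoefB.
have [Ni|/ucm_dvd[M NM]] := eqVneq (N i) 0%N.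
  by rewrite mcoef_varM0 // (Kmu_local (shift_local mu 1 Ni)) subrr.
have iN : i \in finsupp N by rewrite NM mdomD mdomU in_fsetU in_fset1 eqxx.
have MN : (finsupp M `<=` finsupp N)%fset by rewrite NM mdomD fsubsetUr.
rewrite NM mcoef_varM -NM (KmuE _ MN) /= !(big_fsetD1 i iN) /=.
have e1 : \prod_(j <- (finsupp N `\ i)%fset)
      gbinom (Pmu (shift mu i 1) N j + (N j)%:R) (N j) =
    \prod_(j <- (finsupp N `\ i)%fset) gbinom (Pmu mu N j + (N j)%:R) (N j).
  apply: eq_big_seq => j; rewrite in_fsetD1 eq_sym => /andP[/negbTE ij _].
  by rewrite Pmu_shift ij mulr0 subr0.
have e2 : \prod_(j <- (finsupp N `\ i)%fset)
      gbinom (Pmu (mu \+ A i) M j + (M j)%:R) (M j) =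
    \prod_(j <- (finsupp N `\ i)%fset) gbinom (Pmu mu N j + (N j)%:R) (N j).
  apply: eq_big_seq => j; rewrite in_fsetD1 eq_sym => /andP[/negbTE ij _].
  by rewrite NM Pmu_varM cmM cmU ij.
rewrite e1 e2 -mulrBl; congr (_ * _).
rewrite Pmu_shift eqxx mulr1 NM Pmu_varM cmM cmUU add1n.
set p := Pmu _ _ _; have -> : p + (M i).+1%:R = p + (M i)%:R + 1.
  by rewrite -natr1 addrA.
by rewrite gbinom_pascal (_ : _ - 1 + _ = p + (M i)%:R); ring.
Qed.

End Families.

(** * Determinants indexed by sequences *)

Section SequenceDeterminants.
Context (H : choiceType) (K : fieldType).
Implicit Types (s r : seq H) (F G : H -> H -> K).

Definition tupdet n (t : n.-tuple H) F : K :=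
  \det (\matrix_(a < n, b < n) F (tnth t a) (tnth t b)).

Notation seqdet s := (tupdet (in_tuple s)).

(** Transports along equality of sizes, the dimension of [seqdet s] being the
    computed size of [s]. *)
Lemma tupdet_in_tuple n (t : n.-tuple H) F : seqdet t F = tupdet t F.
Proof.
case: t => s e /=; have en : size s = n by exact/eqP.
case: n / en e => e.
by have -> : Tuple e = in_tuple s by apply: val_inj.
Qed.

Lemma seqdet_perm s r F : perm_eq s r -> seqdet s F = seqdet r F.
Proof.
move=> sr; have es : size s == size r by rewrite (perm_size sr).
transitivity (tupdet (Tuple es) F); first exact: (tupdet_in_tuple (Tuple es)).
have /tuple_permP[p sE] : perm_eq s (in_tuple r) by [].
have -> : Tuple es = [tuple tnth (in_tuple r) (p i) | i < size r].
  exact: val_inj.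
rewrite /tupdet; set M := (X in _ = \det X).
transitivity (\det (row_perm p (col_perm p M))).
  by congr (\det _); apply/matrixP => a b; rewrite !mxE !tnth_mktuple.
rewrite row_permE col_permE !det_mulmx !det_perm odd_permV mulrCA.
by rewrite -signr_addb addbb mulr1.
Qed.

Lemma eq_seqdet s F G : {in s &, F =2 G} -> seqdet s F = seqdet s G.
Proof.
move=> FG; congr (\det _); apply/matrixP => a b; rewrite !mxE.
by apply: FG; exact: mem_tnth.
Qed.

Lemma seqdet_tr s F : seqdet s (fun i j => F j i) = seqdet s F.
Proof.
by rewrite /tupdet -det_tr; congr (\det _); apply/matrixP => a b; rewrite !mxE.
Qed.

Lemma seqdet_scale s F (c : H -> K) :
  seqdet s F * \prod_(j <- s) c j = seqdet s (fun i j => F i j * c j).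
Proof.
rewrite big_tnth /tupdet.
pose d : 'rV[K]_(size s) := \row_b c (tnth (in_tuple s) b).
have -> : \prod_(b < size s) c (tnth (in_tuple s) b) = \det (diag_mx d).
  by rewrite det_diag; apply: eq_bigr => b _; rewrite mxE.
rewrite -det_mulmx mul_mx_diag; congr (\det _).
by apply/matrixP => a b; rewrite !mxE.
Qed.

Lemma seqdet_linear s i F G G' (b c : K) : uniq s -> i \in s ->
    (forall k, F i k = b * G i k + c * G' i k) ->
    (forall j k, j != i -> G j k = F j k) ->
    (forall j k, j != i -> G' j k = F j k) ->
  seqdet s F = b * seqdet s G + c * seqdet s G'.
Proof.
move=> us /(@tnthP _ _ (in_tuple s) i)[a ia] Fi GF G'F.
have lifta e : tnth (in_tuple s) (lift a e) != i.
  rewrite ia; apply/eqP => /(elimT (tuple_uniqP (in_tuple s)) us)/eqP.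
  by rewrite eq_sym (negbTE (neq_lift _ _)).
apply: (determinant_multilinear (i0 := a)); apply/matrixP => e k; rewrite !mxE.
- by rewrite -ia Fi.
- by rewrite GF.
- by rewrite G'F.
Qed.

Lemma seqdet_cons i s F : {in s, forall k, F i k = 0} ->
  seqdet (i :: s) F = F i i * seqdet s F.
Proof.
move=> Fi; rewrite /tupdet (expand_det_row _ ord0) big_ord_recl big1 ?addr0 /=.
  rewrite mxE /cofactor expr0 mul1r; congr (_ * \det _).
  by apply/matrixP => a b; rewrite !mxE !(tnth_nth i).
move=> b _; rewrite mxE (_ : F _ _ = 0) ?mul0r //.
rewrite !(tnth_nth i) lift0 /=; apply: Fi; exact: mem_nth.
Qed.

(** Indices whose row is that of the identity do not contribute; hence a
    determinant over the support of a monomial extends to larger index sets. *)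
Lemma seqdet_cat r s F : uniq (r ++ s) ->
  {in r, forall i k, F i k = (i == k)%:R} -> seqdet (r ++ s) F = seqdet s F.
Proof.
elim: r => //= i r IHr /andP[irs us] Fr.
rewrite seqdet_cons ?IHr ?Fr ?mem_head ?eqxx ?mul1r // => [j jr|k ks].
  by apply: Fr; rewrite in_cons jr orbT.
by rewrite Fr ?mem_head //; case: eqP => // ik; rewrite ik ks in irs.
Qed.

Lemma seqdet_eq0 s F (x : H -> K) i : i \in s -> x i != 0 ->
  {in s, forall j, \sum_(k <- s) x k * F j k = 0} -> seqdet s F = 0.
Proof.
move=> /(@tnthP _ _ (in_tuple s) i)[a ia] xi Fx.
rewrite -seqdet_tr; apply/eqP/det0P.
exists (\row_b x (tnth (in_tuple s) b)).
  by apply/eqP => /rowP/(_ a); rewrite !mxE -ia => /eqP; rewrite (negbTE xi).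
apply/rowP => b; rewrite !mxE -[RHS](Fx (tnth (in_tuple s) b)) ?mem_tnth //.
by rewrite [RHS]big_tnth; apply: eq_bigr => c _; rewrite !mxE.
Qed.

End SequenceDeterminants.
Notation seqdet s := (tupdet (in_tuple s)).

(** * The determinantal series *)

Section RFamily.
Context (H : choiceType) (K : numFieldType) (A : H -> H -> K).
Implicit Types (mu : H -> K) (N M : {cmonom H}).

(** What the entries [P_j] and [N_j] of [F] become when the factor
    [binom(P_j + N_j - 1, N_j - 1) / N_j] is moved inside the determinant.  The
    values at [n = 0] are those that obey Pascal's rule, and they make the rows
    outside the support of [N] trivial. *)
Definition Rdiag (p : K) n := gbinom (p + n%:R - 1) n.
Definition Roff (p : K) n := if n is m.+1 then gbinom (p + m%:R) m else 0.

Lemma Rdiag_pascal p n : Rdiag p n.+1 - Rdiag (p - 1) n.+1 = Rdiag p n.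
Proof.
rewrite /Rdiag -natr1.
have -> : p + (n%:R + 1) - 1 = p + n%:R - 1 + 1 by ring.
have -> : p - 1 + (n%:R + 1) - 1 = p + n%:R - 1 by ring.
by rewrite gbinom_pascal addrAC subrr add0r.
Qed.

Lemma Roff_pascal p n : Roff p n.+1 - Roff (p - 1) n.+1 = Roff p n.
Proof.
case: n => [|n] /=; first by rewrite !gbinom0 subrr.
rewrite -natr1 addrA gbinom_pascal.
have -> : p - 1 + (n%:R + 1) = p + n%:R by ring.
by rewrite addrAC subrr add0r.
Qed.

Lemma Rdiag_Roff p n : n%:R * Rdiag p n = p * Roff p n.
Proof.
case: n => [|n]; first by rewrite mul0r mulr0.
rewrite /Rdiag /= -{2}natr1 addrA addrK gbinom_absorb.
by rewrite addrK.
Qed.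

(** Transposed, so that the binomial factors of the index [j] sit in a row. *)
Definition Rrow mu N (j i : H) : K :=
  (j == i)%:R * Rdiag (Pmu A mu N j) (N j) + A i j * Roff (Pmu A mu N j) (N j).

Definition Rmu mu : mseries H K :=
  MSeries (fun N => seqdet (finsupp N) (Rrow mu N)).

Lemma RmuE mu N (L : {fset H}) : (finsupp N `<=` L)%fset ->
  Rmu mu N = seqdet L (Rrow mu N).
Proof.
move=> NL; have us :
  uniq (enum_fset (L `\` finsupp N)%fset ++ enum_fset (finsupp N)).
  rewrite cat_uniq !fset_uniq andbT /=; apply/hasPn => i iN.
  by rewrite in_fsetD iN.
have pL : perm_eq L (enum_fset (L `\` finsupp N)%fset ++ enum_fset (finsupp N)).
  apply: uniq_perm => // i; rewrite mem_cat in_fsetD.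
  by case: (boolP (i \in finsupp N)) => [/(fsubsetP NL)->|]; rewrite ?orbT ?orbF.
rewrite (seqdet_perm _ pL) seqdet_cat // => i.
rewrite in_fsetD -cmE_eq0 => /andP[/eqP Ni _] k.
by rewrite /Rrow Ni /Rdiag gbinom0 /= mulr0 addr0 mulr1.
Qed.

Lemma Rmu_local N mu mu' :
  {in finsupp N, mu =1 mu'} -> Rmu mu N = Rmu mu' N.
Proof. by move=> e; apply: eq_seqdet => j i jN _; rewrite /Rrow /Pmu e. Qed.

(** A unit shift of [mu_i] changes only the [i]-th row, where Pascal's rule makes
    the difference of the two rows that of [N / w_i]; the determinant is linear in
    that row. *)
Lemma Qfamily_R : Qfamily A Rmu.
Proof.
split=> [mu i| |mu i N]; last 2 first.
- exact: Rmu_local.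
- apply: polyfun_det => a b.
  under eq_fun do rewrite mxE /Rrow Pmu_shift /Roff.
  set j := tnth _ a; set k := tnth _ b.
  have pP : polyfun (fun t => Pmu A mu N j - t * (i == j)%:R).
    apply: polyfunB; first exact: polyfun_cst.
    by apply: polyfunM; [exact: polyfun_id|exact: polyfun_cst].
  apply: polyfunD; (apply: polyfunM; first exact: polyfun_cst).
    apply: polyfun_gbinom; apply: polyfunB; last exact: polyfun_cst.
    by apply: polyfunD => //; exact: polyfun_cst.
  case: (N j) => [|m]; first exact: polyfun_cst.
  by apply: polyfun_gbinom; apply: polyfunD => //; exact: polyfun_cst.
apply: mseriesP => N; rewrite mcoefB.
have [Ni|/ucm_dvd[M NM]] := eqVneq (N i) 0%N.
  by rewrite mcoef_varM0 // (Rmu_local (shift_local mu 1 Ni)) subrr.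
have iN : i \in finsupp N by rewrite NM mdomD mdomU in_fsetU in_fset1 eqxx.
have MN : (finsupp M `<=` finsupp N)%fset by rewrite NM mdomD fsubsetUr.
rewrite NM mcoef_varM -NM (RmuE _ MN) /=.
rewrite (@seqdet_linear _ _ _ i (Rrow (mu \+ A i) M)
  (Rrow mu N) (Rrow (shift mu i 1) N) 1 (- 1)) ?fset_uniq //.
- by rewrite mul1r mulN1r.
- move=> k; rewrite /Rrow Pmu_shift eqxx mulr1 NM Pmu_varM cmM cmUU add1n.
  by rewrite -Rdiag_pascal -Roff_pascal; ring.
- by move=> j k; rewrite eq_sym => /negbTE ij; rewrite /Rrow NM Pmu_varM cmM cmU ij.
- move=> j k; rewrite eq_sym => /negbTE ij; rewrite /Rrow Pmu_shift NM.
  by rewrite Pmu_varM cmM cmU ij mulr0 subr0.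
Qed.

(** For [mu = 0] one has [P_j = - sum_i N_i A_ij], so the vector [N] is in the
    kernel of the matrix by [Rdiag_Roff]. *)
Lemma Rmu0 : Rmu (fun=> 0) = 1.
Proof.
apply: mseriesP => N; rewrite mcoef1; have [->|N1] := eqVneq N mone.
  rewrite (@RmuE _ _ fset0) ?mdom1 //.
  rewrite (@seqdet_perm _ _ _ [::]); first exact: det_mx00.
  by apply: uniq_perm => // i; rewrite in_fset0.
have [i iN] : exists i, i \in finsupp N.
  by apply/fset0Pn; apply: contra N1 => /eqP N0;
    rewrite -mdeg_eq0 mdegE N0 big_seq_fset0.
apply: (@seqdet_eq0 _ _ _ _ (fun i => (N i)%:R) i) => //.
  by rewrite pnatr_eq0 cmE_neq0.
move=> j jN; rewrite /Rrow.
under eq_bigr do rewrite mulrDr.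
rewrite big_split /= (big_fsetD1 j) //= eqxx mul1r big_seq big1 ?addr0; last first.
  move=> k; rewrite in_fsetD1 eq_sym => /andP[/negbTE-> _].
  by rewrite mul0r mulr0.
under eq_bigr do rewrite mulrA.
by rewrite -mulr_suml Rdiag_Roff -mulrDl /Pmu oppr0 sub0r addNr mul0r.
Qed.

(** Moves the product of binomial factors inside the determinant; it has an
    [N_i] in a denominator, but only for [i] in the support of [N]. *)
Lemma Rmu_fset_det mu N :
  fset_det (finsupp N) (fun i j => (i == j)%:R * Pmu A mu N j + A i j * (N j)%:R) *
  \prod_(i <- finsupp N)
    ((N i)%:R^-1 * gbinom (Pmu A mu N i + (N i)%:R - 1) (N i).-1) = Rmu mu N.
Proof.
rewrite [fset_det _ _](_ : _ = seqdet (finsupp N)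
  (fun i j => (i == j)%:R * Pmu A mu N j + A i j * (N j)%:R)) //.
rewrite seqdet_scale -[RHS]seqdet_tr; apply: eq_seqdet => i j _.
rewrite -cmE_neq0 /Rrow (eq_sym j); set p := Pmu _ _ _ _.
have := Rdiag_Roff p (N j); rewrite /Rdiag.
case: (N j) => //= n + _.
have n0 : (n.+1%:R : K) != 0 by rewrite pnatr_eq0.
have -> : p + n.+1%:R - 1 = p + n%:R by rewrite -natr1 addrA addrK.
set g := gbinom _ n; set h := gbinom _ n.+1 => pg; set d := (i == j)%:R.
have -> : h = p * g / n.+1%:R by rewrite -pg mulrAC mulfV ?mul1r.
by field; rewrite nat1r.
Qed.

End RFamily.

(** * Infinite products *)

Lemma eqmod_prod_sub (H : choiceType) (K : fieldType) (L : {fset H}) d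
    (F : H -> mseries H K) (J J' : {fset H}) : (J `<=` J')%fset ->
  (forall j, j \notin J -> eqmod L d (F j) 1) ->
  eqmod L d (\prod_(j <- J') F j) (\prod_(j <- J) F j).
Proof.
move=> JJ' F1; pose F' j := if j \in J then F j else 1.
apply: (@eqmod_trans _ _ _ _ _ (\prod_(j <- J') F' j)).
  apply: eqmod_prod => j _; rewrite /F'; case: ifPn => // jJ; exact: F1.
rewrite -(big_fset_incl _ JJ') => [|j _ jJ]; last by rewrite /F' (negbTE jJ).
rewrite (eq_big_seq F) => [|j jJ]; first exact: eqmod_refl.
by rewrite /F' jJ.
Qed.

Section InfiniteProducts.
Context (H : countType) (K : numFieldType).
Hypothesis H_infinite : infinite_set [set: H].
Implicit Types (F : H -> mseries H K) (f g : mseries H K) (L J : {fset H}).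

(** Along any enumeration, the partial products eventually contain the finitely
    many factors that are not congruent to 1. *)
Lemma eqmod_partial_prods L d F J (s : nat -> H) : bijective s ->
  (forall j, j \notin J -> eqmod L d (F j) 1) ->
  \forall n \near \oo,
    eqmod L d (\prod_(k < n) F (s k)) (\prod_(j <- J) F j).
Proof.
move=> [s' sK s'K] F1; exists (\max_(j <- J) (s' j).+1)%N => // n /= len.
pose T := [fset x in map s (iota 0 n)]%fset.
have -> : \prod_(k < n) F (s k) = \prod_(j <- T) F j.
  rewrite -(big_mkord xpredT (F \o s)) -(big_map s xpredT F) /index_iota subn0.
  apply: perm_big; apply: uniq_perm; rewrite ?fset_uniq //.
    by rewrite map_inj_uniq ?iota_uniq //; exact: can_inj sK.
  by move=> j; rewrite !inE.
apply: eqmod_prod_sub => //; apply/fsubsetP => j jJ; rewrite !inE.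
rewrite -[j]s'K map_f // mem_iota add0n /= (leq_trans _ len) //.
exact: (@leq_bigmax_seq _ _ xpredT (fun j => (s' j).+1)).
Qed.

Lemma mprod_cvg_to_local F f :
  (forall L d, exists2 J : {fset H}, forall j, j \notin J -> eqmod L d (F j) 1 &
     eqmod L d (\prod_(j <- J) F j) f) -> mprod_cvg_to F f.
Proof.
move=> Ff s bs L d; have [J F1 FJ] := Ff L d.
have := eqmod_partial_prods bs F1; apply: filterS => n e.
exact: eqmod_trans FJ.
Qed.

Lemma enumeration_exists : exists s : nat -> H, bijective s.
Proof.
have /card_set_bijP[f] := eq_card_nat (countableP [set: H]) H_infinite.
by rewrite setTT_bijective => -[s fK sK]; exists s; exists f.
Qed.

(** Convergence is a statement about all the enumerations of the index set, so
    drawing a conclusion from it requires that there be one. *)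
Lemma mprod_cvg_to_eqmod L d F f J : mprod_cvg_to F f ->
  (forall j, j \notin J -> eqmod L d (F j) 1) ->
  eqmod L d f (\prod_(j <- J) F j).
Proof.
move=> Ff F1; have [s bs] := enumeration_exists.
have [n [e1 e2]] := filter_ex (filterI (Ff s bs L d) (eqmod_partial_prods bs F1)).
exact: (eqmod_trans (eqmod_sym e1)).
Qed.

Lemma mprod_cvg_to_unique F f g : mprod_cvg_to F f -> mprod_cvg_to F g -> f = g.
Proof.
move=> Ff Fg; have [s bs] := enumeration_exists; apply: eqmod_eq => L d.
have [n [e1 e2]] := filter_ex (filterI (Ff s bs L d) (Fg s bs L d)).
exact: (eqmod_trans (eqmod_sym e1)).
Qed.

Lemma mprodE F f : mprod_cvg_to F f -> mprod F = f.
Proof.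
move=> Ff; apply: (mprod_cvg_to_unique _ Ff).
by apply: xgetPex; exists f.
Qed.

Lemma mprodP F : mprod_cvg F -> mprod_cvg_to F (mprod F).
Proof. exact: xgetPex. Qed.

Lemma mprod_cvg_to_mpow F f c : (forall j, F j mone = 1) ->
  mprod_cvg_to F f -> mprod_cvg_to (fun j => mpow (F j) c) (mpow f c).
Proof.
move=> F1 Ff s bs L d; have := Ff s bs L d; apply: filterS => n e.
by rewrite -(mpow_prod _ c) //; apply: eqmod_mpow.
Qed.

End InfiniteProducts.

(** * The standard system *)

Section StandardSystem.
Context (H : choiceType) (K : numFieldType) (A : H -> H -> K).
Context (U : H -> mseries H K).
Hypothesis U1 : forall j, U j mone = 1.
Hypothesis U_off : forall L d j, j \notin L -> eqmod L d (U j) 1.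
Implicit Types (mu : H -> K) (L : {fset H}).

Lemma mpow_off L d a j : j \notin L -> eqmod L d (mpow (U j) a) 1.
Proof. by move=> jL; rewrite -(mpow1l H a); apply/eqmod_mpow/U_off. Qed.

(** The infinite product of the [U_j^(mu_j)], defined coefficientwise by finite
    products, which is legitimate by [WmuE]. *)
Definition Wmu mu : mseries H K :=
  MSeries (fun N => (\prod_(j <- finsupp N) mpow (U j) (mu j)) N).

Lemma WmuE L d mu : eqmod L d (Wmu mu) (\prod_(j <- L) mpow (U j) (mu j)).
Proof.
move=> N NL _; apply/esym.
apply: (@eqmod_prod_sub _ _ (finsupp N) (mdeg N).+1) => // j jN.
exact: mpow_off.
Qed.

Lemma WmuD mu mu' : Wmu (mu \+ mu') = Wmu mu * Wmu mu'.
Proof.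
apply: eqmod_eq => L d; apply: (eqmod_trans (@WmuE L d _)).
under eq_bigr do rewrite mpowD //.
rewrite big_split; apply: eqmod_sym; apply: eqmodM; exact: WmuE.
Qed.

Lemma Wmu0 : Wmu (fun=> 0) = 1.
Proof.
apply: eqmod_eq => L d; apply: (eqmod_trans (@WmuE L d _)).
by rewrite big1 // => j _; rewrite mpow0.
Qed.

Lemma Wmu_delta i : Wmu (fun j => 1 * (i == j)%:R) = U i.
Proof.
apply: eqmod_eq => L d; apply: (eqmod_trans (@WmuE L d _)).
case: (boolP (i \in L)) => iL.
  rewrite (big_fsetD1 i) //= eqxx mulr1 mpow1 // big_seq big1 ?mulr1 // => j.
  by rewrite in_fsetD1 eq_sym => /andP[/negbTE-> _]; rewrite mulr0 mpow0.
rewrite big_seq big1; first by apply: eqmod_sym; exact: U_off.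
move=> j jL; case: eqP => [ij|_]; last by rewrite mulr0 mpow0.
by rewrite ij jL in iL.
Qed.

Hypothesis U_eq : forall i, U i + mvar K i * Wmu (A i) = 1.

(** The recurrence is the equation of the system multiplied by [W(mu)]. *)
Lemma Qfamily_W : Qfamily A Wmu.
Proof.
split=> [mu i|N mu mu' eq_mu|mu i N].
- rewrite WmuD -[shift mu i 1]/(mu \+ _) WmuD Wmu_delta -{1}[Wmu mu]mulr1.
  by rewrite -mulrBr -[X in X - U i](U_eq i) addrAC subrr add0r -mulrCA.
- rewrite /= (eq_big_seq (fun j => mpow (U j) (mu' j))) // => j jN.
  by rewrite eq_mu.
- apply: polyser_prod => j; apply: polyser_mpow; apply: polyfunD.
    exact: polyfun_cst.
  by apply: polyfunM; [exact: polyfun_id|exact: polyfun_cst].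
Qed.

(** Uniqueness applied twice: the values at 0 agree by [Wmu0] and [Rmu0]. *)
Lemma standard_Qsystem mu :
  Kmu A mu = Kmu A (fun=> 0) * Wmu mu /\ Wmu mu = Rmu A mu.
Proof.
split; move: mu.
  apply: Qfamily_inj; first exact: Qfamily_K.
    exact/Qfamily_mull/Qfamily_W.
  by rewrite Wmu0 mulr1.
by apply: Qfamily_inj; [exact: Qfamily_W|exact: Qfamily_R|rewrite Wmu0 Rmu0].
Qed.

End StandardSystem.

(** * Canonical solutions *)

Section CanonicalSolutions.
Context (H : countType) (K : numFieldType).
Hypothesis H_infinite : infinite_set [set: H].
Context (D G Dinv : H -> H -> K) (Q : H -> mseries H K).
Hypothesis GDinvP : imx_mul_def G Dinv.
Hypothesis QP : canonical_solution D Dinv G Q.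

Let U i := mprod (fun j => mpow (Q j) (D i j)).

Lemma Qprod_eq i :
  U i + mvar K i * mprod (fun j => mpow (Q j) (G i j)) = 1.
Proof. by have [[_ /(_ i)[]]] := QP. Qed.

Lemma Qprod_mone i : U i mone = 1.
Proof.
have := congr1 (fun f : mseries H K => f mone) (Qprod_eq i).
by rewrite mcoefD mcoef_varM0 ?cm1 // addr0 mcoef1 eqxx.
Qed.

Lemma Qprod_off (L : {fset H}) d i : i \notin L -> eqmod L d (U i) 1.
Proof.
move=> iL N NL _; rewrite -[1 in RHS](Qprod_eq i) mcoefD mcoef_varM0 ?addr0 //.
by apply/eqP; rewrite cmE_eq0; apply: contra iL; exact: (fsubsetP NL).
Qed.

(** Powers commute with convergent products, so the inner products in the
    definition of a canonical solution are the [U_j^(D^-1)_ij]. *)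
Lemma Q_canonical i : mprod_cvg_to (fun j => mpow (U j) (Dinv i j)) (Q i).
Proof.
have [[Q1 QS] /(_ i)[_]] := QP; congr mprod_cvg_to; apply/funext => j.
apply: mprodE => //.
have -> : (fun k => mpow (Q k) (Dinv i j * D j k)) =
          (fun k => mpow (mpow (Q k) (D j k)) (Dinv i j)).
  by apply/funext => k; rewrite mpowM // mulrC.
apply: mprod_cvg_to_mpow => [k|]; first exact: mpow_mone.
by apply: mprodP; have [] := QS j.
Qed.

(** Modulo the variables outside a finite set [L], each [Q_i] is a finite product
    of powers of the [U_j] with [j] in [L], and the condition on [nu] leaves only
    finitely many [i] for which one of the exponents [nu_i (D^-1)_ij] is nonzero;
    the products can then be exchanged. *)
Lemma Qnu_cvg nu : nu_set Dinv nu ->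
  mprod_cvg_to (fun i => mpow (Q i) (nu i))
    (Wmu U (fun j => \sum_(i \in [set: H]) nu i * Dinv i j)).
Proof.
move=> nuP; have U1 := Qprod_mone.
apply: mprod_cvg_to_local => L d.
pose J := (\bigcup_(j <- L) fset_set [set i | nu i * Dinv i j != 0])%fset.
have J0 i j : i \notin J -> j \in L -> nu i * Dinv i j = 0.
  move=> iJ jL; apply/eqP; apply: contraNT iJ => nz.
  by apply/bigfcupP; exists j; rewrite ?jL // in_fset_set ?inE //; exact: nuP.
have Qi i : eqmod L d (mpow (Q i) (nu i))
                      (\prod_(j <- L) mpow (U j) (nu i * Dinv i j)).
  have -> : \prod_(j <- L) mpow (U j) (nu i * Dinv i j) =
      mpow (\prod_(j <- L) mpow (U j) (Dinv i j)) (nu i).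
    rewrite mpow_prod => [|j]; last exact: mpow_mone.
    by apply: eq_bigr => j _; rewrite mpowM // mulrC.
  apply: eqmod_mpow; apply: mprod_cvg_to_eqmod (Q_canonical i) _ => // j.
  by apply: mpow_off => *; exact: Qprod_off.
exists J => [i iJ|].
  apply: (eqmod_trans (Qi i)); rewrite big_seq big1 // => j jL.
  by rewrite J0 // mpow0.
apply: (@eqmod_trans _ _ _ _ _
  (\prod_(i <- J) \prod_(j <- L) mpow (U j) (nu i * Dinv i j))).
  by apply: eqmod_prod => i _; exact: Qi.
rewrite exchange_big /= (eq_big_seq (fun j =>
  mpow (U j) (\sum_(i \in [set: H]) nu i * Dinv i j))) => [|j jL].
  by apply/eqmod_sym/WmuE => *; exact: Qprod_off.
by rewrite mpow_sum // (@fsbigTE _ _ _ _ J) // => i iJ; rewrite J0.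
Qed.

(** The rows of [G] satisfy the condition on [nu] because [G D^-1] is
    well-defined. *)
Lemma Qprod_standard i : U i + mvar K i * Wmu U (imx_mul G Dinv i) = 1.
Proof.
rewrite -[RHS](Qprod_eq i); congr (_ + _ * _); apply/esym.
by apply: mprodE => //; apply: Qnu_cvg => j; exact: GDinvP.
Qed.

Lemma canonical_Qnu nu : nu_set Dinv nu ->
  [/\ mprod_cvg (fun i => mpow (Q i) (nu i)),
      Kseries Dinv G nu = Kseries Dinv G (fun=> 0) * Qnu Q nu &
      Qnu Q nu = Rseries Dinv G nu].
Proof.
move=> nuP; set A := imx_mul G Dinv.
pose mu j := \sum_(i \in [set: H]) nu i * Dinv i j.
have Qcvg : mprod_cvg_to _ (Wmu U mu) := Qnu_cvg nuP.
have -> : Qnu Q nu = Wmu U mu by exact: mprodE.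
have [KW WR] := standard_Qsystem Qprod_mone Qprod_off Qprod_standard mu.
split; first by exists (Wmu U mu).
  transitivity (Kmu A mu); first exact: mseriesP.
  rewrite KW; congr (_ * _); apply: mseriesP => N; apply: eq_bigr => i _.
  by rewrite /Pnu fsbig1 // => j _; rewrite mul0r.
by rewrite WR; apply: mseriesP => N; rewrite -Rmu_fset_det.
Qed.

End CanonicalSolutions.

Theorem theorem3p10 (R : realType) (H : countType)
    (H_infinite : infinite_set [set: H])
    (D G Dinv : H -> H -> R[i])
    (DinvP : imx_inverse D Dinv) (GDinvP : imx_mul_def G Dinv)
    (Q : H -> mseries H R[i]) (QP : canonical_solution D Dinv G Q)
    (nu : H -> R[i]) (nuP : nu_set Dinv nu) :
  [/\ mprod_cvg (fun i => mpow (Q i) (nu i)),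
      Qnu Q nu = Kseries Dinv G nu / Kseries Dinv G (fun=> 0) &
      Kseries Dinv G nu / Kseries Dinv G (fun=> 0) = Rseries Dinv G nu].
Proof.
have [Qcvg -> <-] := canonical_Qnu H_infinite GDinvP QP nuP.
by rewrite [_ * Qnu Q nu]mulrC mulrK // Kseries_unit.
Qed.
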